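(* Let $L\subset\mathbb{Z}^n$ be a pure lattice (i.e. $L=L_{pure}$) of rank $r$, let $\sigma=\operatorname{supp}(L)$ and let $S$ be a set of $r$ binomials of $I_L$. The set $S$ generates $I_L$ if and only if there is a rearrangement $\{x^{u_1}-x^{v_1},x^{u_2}-x^{v_2},\ldots,x^{u_r}-x^{v_r}\}$ of $S$ such that the following three conditions are satisfied: (1) $\{u_1-v_1,\ldots,u_r-v_r\}$ is a basis of $L$ (as a $\mathbb{Z}$-module); (2) for each $i\in\{1,\dots,r\}$, $\operatorname{supp}(u_i)\cup\operatorname{supp}(v_i)\subset\sigma$; (3) (a) $x^{v_1}=1$, and (b) $\operatorname{supp}(v_i)\subset\bigcup_{j=1}^{i-1}\operatorname{supp}(u_j)$ for $2\le i\le r$.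
   Context: Let $\Bbbk$ be a field, $R=\Bbbk[x_1,\ldots,x_n]$, $\mathbb{N}=\mathbb{Z}_{\ge0}$. A lattice is a subgroup $L\subset\mathbb{Z}^n$; $I_L=\langle x^u-x^v:u,v\in\mathbb{N}^n,\ u-v\in L\rangle\subset R$. $L_{pure}$ is the subgroup of $L$ generated by $L\cap\mathbb{N}^n$. For a vector $u$, $\operatorname{supp}(u)=\{i:u_i\neq0\}$, and for a set $X\subset\mathbb{Z}^n$, $\operatorname{supp}(X)=\bigcup_{w\in X}\operatorname{supp}(w)$. A binomial means a difference $x^u-x^v$ of two distinct monomials. A rearrangement of a finite set of binomials $S=\{B_1,\ldots,B_r\}$ is a set $S'$ obtained by reordering the binomials of $S$ and possibly changing the signs of some of them. *)

(* Defs.v *)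
From HB Require Import structures.
From mathcomp Require Import all_boot all_order all_algebra.
From mathcomp Require Import finmap mpoly.

Set Implicit Arguments.
Unset Strict Implicit.
Unset Printing Implicit Defensive.

Import GRing.Theory.

Local Open Scope ring_scope.

(* Lattices are given as [L : zmodClosed 'rV[int]_n], i.e., as subgroups of    *)
(* Z^n with boolean membership; this is no restriction, since a subgroup of   *)
(* Z^n is finitely generated.                                                 *)

Section Lattices.
Variable n : nat.
Implicit Types (L : zmodClosed 'rV[int]_n) (w : 'rV[int]_n).

Definition subgroup_gen (X : 'rV[int]_n -> Prop) w : Prop :=
  exists (m : nat) (c : 'I_m -> int) (g : 'I_m -> 'rV[int]_n),
    (forall i, X (g i)) /\ w = \sum_i c i *: g i.

Definition pure_part L : 'rV[int]_n -> Prop :=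
  subgroup_gen (fun w => w \in L /\ forall k, 0 <= w 0 k).

Definition pure_lattice L : Prop := forall w, w \in L <-> pure_part L w.

Definition lattice_basis L (r : nat) (b : 'I_r -> 'rV[int]_n) : Prop :=
  [/\ forall i, b i \in L,
      forall w, w \in L -> exists c : 'I_r -> int, w = \sum_i c i *: b i
    & forall c : 'I_r -> int, \sum_i c i *: b i = 0 -> forall i, c i = 0].

Definition lattice_rank L (r : nat) : Prop :=
  exists b : 'I_r -> 'rV[int]_n, lattice_basis L b.

Definition supp w : {set 'I_n} := [set k | w 0 k != 0].

Definition lattice_supp L (k : 'I_n) : Prop := exists2 w, w \in L & k \in supp w.

(* Subtraction on ['X_{1..n}] is truncated, so differences of exponents are    *)
(* taken after this embedding of N^n into Z^n.                                *)
Definition mnmZ (u : 'X_{1..n}) : 'rV[int]_n := \row_k (u k)%:Z.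

End Lattices.

Section LatticeIdeals.
Variables (K : fieldType) (n : nat).
Implicit Types (p : {mpoly K[n]}) (u v : 'X_{1..n}).

Definition ideal_gen (G : {mpoly K[n]} -> Prop) p : Prop :=
  exists (m : nat) (a g : 'I_m -> {mpoly K[n]}),
    (forall i, G (g i)) /\ p = \sum_i a i * g i.

Definition lattice_ideal (L : zmodClosed 'rV[int]_n) : {mpoly K[n]} -> Prop :=
  ideal_gen (fun p => exists u v,
    mnmZ u - mnmZ v \in L /\ p = 'X_[u] - 'X_[v]).

Definition binomial_poly p : Prop :=
  exists u v, u != v /\ p = 'X_[u] - 'X_[v].

Definition generates (S : {fset {mpoly K[n]}}) (I : {mpoly K[n]} -> Prop) :=
  forall p, ideal_gen (fun q => q \in S) p <-> I p.

Definition rearrangement (S : {fset {mpoly K[n]}}) (r : nat)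
    (B' : 'I_r -> {mpoly K[n]}) : Prop :=
  exists B : 'I_r -> {mpoly K[n]},
    [/\ injective B,
        forall p, p \in S <-> exists i, p = B i
      & forall i, B' i = B i \/ B' i = - B i].

End LatticeIdeals.

(* Main.v *)
Require Import Defs.
From HB Require Import structures.
From mathcomp Require Import all_boot all_order all_algebra.
From mathcomp Require Import finmap mpoly freeg.
From mathcomp Require boolp.

(** Both directions reduce to congruences on the monoid N^n of monomials, that
    is, equivalence relations compatible with addition. On one hand, the pairs
    (u, v) such that x^u - x^v lies in a given ideal form a congruence
    ([ideal_congruence]). On the other hand, an ideal generated by binomials
    whose two monomials are congruent contains no binomial whose monomials are
    not: summing the coefficients over one congruence class is a linear form
    that kills the ideal ([congruent_of_ideal_gen]).

    Sufficiency of the three conditions. Modulo the ideal generated by S, the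
    monomial x^{u_1} is 1, hence the variables in supp(u_1) are invertible; the
    support condition on v_2 makes x^{v_2} invertible, so x^{u_2} and all its
    variables are invertible too, and so on. A relation
    u - v = sum_i c_i (u_i - v_i) becomes a congruence between u and v after
    adding to both sides a monomial in these variables, and this monomial can be
    cancelled ([congruent_of_chain]).

    Necessity. Fix a set C of generators and a set X of variables, such that
    both monomials of the members of C are supported in X while neither monomial
    of the other generators is. The relation saying that u and v are both
    supported in X with u - v in the span of C, or are both not supported in X,
    is a congruence containing all the generators. If w >= 0 is in L, then
    x^w - 1 is in the ideal, so w is congruent to 0: it lies in the span of C.
    As L is pure, such w generate L, so C spans L ([lattice_sub_span_on]).
    - When C contains all the generators, their r exponent differences span L;
      since L has rank r they form a basis ([generators_basis]).
    - It follows that C is not a proper subset: as long as some generators have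
      not been chosen, one of them has a monomial supported in the variables of
      the chosen ones ([generators_greedy]). Choosing it next, with this
      monomial as x^{v_i}, builds the rearrangement ([greedy_ordering]).
    The support condition with respect to L then follows by induction along the
    rearrangement ([lattice_supp_chain]). *)

Set Implicit Arguments.
Unset Strict Implicit.
Unset Printing Implicit Defensive.

Import GRing.Theory.

Local Open Scope ring_scope.

(** * Ideals generated by a set of polynomials *)

Section IdealGen.
Variables (K : fieldType) (n : nat).
Implicit Types (G : {mpoly K[n]} -> Prop) (p q : {mpoly K[n]}).

Lemma ideal_gen0 G : ideal_gen G 0.
Proof.
exists 0%N, (fun=> 0), (fun=> 0).
by split=> [[]|]; rewrite ?big_ord0.
Qed.

Lemma ideal_genD G p q : ideal_gen G p -> ideal_gen G q -> ideal_gen G (p + q).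
Proof.
move=> [m1 [a1 [g1 [Gg1 ->]]]] [m2 [a2 [g2 [Gg2 ->]]]].
pose cat (f1 : 'I_m1 -> _) (f2 : 'I_m2 -> _) i : {mpoly K[n]} :=
  match split i with inl j => f1 j | inr j => f2 j end.
exists (m1 + m2)%N, (cat a1 a2), (cat g1 g2); split=> [i|].
  by rewrite /cat; case: (split i).
rewrite big_split_ord /=; congr (_ + _); apply: eq_bigr => i _; rewrite /cat.
  by rewrite (unsplitK (inl _ i)).
by rewrite (unsplitK (inr _ i)).
Qed.

Lemma ideal_genM G a p : ideal_gen G p -> ideal_gen G (a * p).
Proof.
move=> [m [b [g [Gg ->]]]]; exists m, (fun i => a * b i), g; split=> //.
by rewrite mulr_sumr; apply: eq_bigr => i _; rewrite mulrA.
Qed.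

Lemma ideal_gen_id G p : G p -> ideal_gen G p.
Proof.
move=> Gp; exists 1%N, (fun=> 1), (fun=> p); split=> //.
by rewrite big_ord1 mul1r.
Qed.

Lemma ideal_gen_sub G (H : {mpoly K[n]} -> Prop) p :
  (forall g, G g -> ideal_gen H g) -> ideal_gen G p -> ideal_gen H p.
Proof.
move=> GH [m [a [g [Gg ->]]]]; elim/big_ind: _ => [|q1 q2|i _].
- exact: ideal_gen0.
- exact: ideal_genD.
- exact/ideal_genM/GH.
Qed.

End IdealGen.

(** * Congruences on monomials and binomial ideals *)

Record congruence (n : nat) (E : 'X_{1..n} -> 'X_{1..n} -> Prop) : Prop :=
  Congruence {
    cong_refl : forall u, E u u;
    cong_sym : forall u v, E u v -> E v u;
    cong_trans : forall v u w, E u v -> E v w -> E u w;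
    cong_addr : forall w u v, E u v -> E (u + w)%MM (v + w)%MM }.

Lemma ideal_congruence (K : fieldType) (n : nat) (G : {mpoly K[n]} -> Prop) :
  congruence (fun u v => ideal_gen G ('X_[u] - 'X_[v])).
Proof.
split=> [u|u v uv|v u w uv vw|w u v uv].
- by rewrite subrr; exact: ideal_gen0.
- by rewrite -opprB -mulN1r; exact: ideal_genM.
- by rewrite -(subrK 'X_[v] 'X_[u]) -addrA; exact: ideal_genD.
- by rewrite !mpolyXD -mulrBl mulrC; exact: ideal_genM.
Qed.

(** The coefficients of x^w (x^u - x^v), for u congruent to v, cancel when they
    are added up over a congruence class, because w + u and w + v are in the
    same class. Hence the form [phi], the sum of the coefficients over the class
    of v, vanishes on the ideal; on x^u - x^v it is -1 unless u is in that
    class. *)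
Lemma congruent_of_ideal_gen (K : fieldType) (n : nat)
    (G : {mpoly K[n]} -> Prop) (E : 'X_{1..n} -> 'X_{1..n} -> Prop) :
  congruence E ->
  (forall g, G g -> exists u v, E u v /\ g = 'X_[u] - 'X_[v]) ->
  forall u v, ideal_gen G ('X_[u] - 'X_[v]) -> E u v.
Proof.
move=> congE GE u v uv.
pose chi (m : 'X_{1..n}) : K^o := (boolp.asbool (E m v))%:R.
pose phi (p : {mpoly K[n]}) : K^o := fglift chi p.
have phiB p q : phi (p - q) = phi p - phi q.
  exact: (lift_is_additive chi).
have phi0 : phi 0 = 0 by rewrite -(subrr 0) phiB subrr.
have phiD p q : phi (p + q) = phi p + phi q.
  by rewrite -[q in LHS]opprK -[- q]sub0r !phiB phi0 sub0r opprK.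
have phiX c m : phi (c *: 'X_[m]) = c * chi m.
  have -> : c *: 'X_[m] = [mpoly << c *g m >>].
    apply/mpolyP => k; rewrite mcoeffZ mcoeffX mcoeff_MPoly coeffU.
    by rewrite eq_sym.
  exact: liftU.
have chiE m m' : E m m' -> chi m = chi m'.
  move=> mm'; congr (_%:R); congr (nat_of_bool _).
  apply/boolp.asboolP/boolp.asboolP.
    exact/(cong_trans congE)/(cong_sym congE).
  exact: (cong_trans congE).
have phiG p : ideal_gen G p -> phi p = 0.
  move=> [m [a [g [Gg ->]]]].
  elim/big_ind: _ => // [p1 p2 p1_0 p2_0|i _].
    by rewrite phiD p1_0 p2_0 addr0.
  have [u' [v' [u'v' ->]]] := GE _ (Gg i).
  rewrite [a i]mpolyE mulr_suml.
  elim/big_ind: _ => // [p1 p2 p1_0 p2_0|w _].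
    by rewrite phiD p1_0 p2_0 addr0.
  rewrite -scalerAl mulrBr -!mpolyXD scalerBr phiB !phiX.
  rewrite (chiE (w + u')%MM (w + v')%MM) ?subrr //.
  by rewrite ![(w + _)%MM]addmC; exact: (cong_addr congE).
have := phiG _ uv; rewrite -[X in X - _]scale1r -[X in _ - X]scale1r phiB !phiX.
rewrite !mul1r /chi.
have -> : boolp.asbool (E v v) by apply/boolp.asboolP/(cong_refl congE).
case: boolp.asboolP => // _ /eqP.
by rewrite sub0r oppr_eq0 oner_eq0.
Qed.

(** * Exponent vectors inside Z^n *)

Section MonomialsInZn.
Variable n : nat.
Implicit Types u v : 'X_{1..n}.

Lemma mnmZD u v : mnmZ (u + v)%MM = mnmZ u + mnmZ v.
Proof. by apply/rowP => k; rewrite !mxE mnmDE PoszD. Qed.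

Lemma mnmZ0 : mnmZ (0%MM : 'X_{1..n}) = 0.
Proof. by apply/rowP => k; rewrite !mxE mnm0E. Qed.

Lemma mnmZ_inj : injective (@mnmZ n).
Proof.
move=> u v /rowP uv; apply/mnmP => k.
by have := uv k; rewrite !mxE => -[].
Qed.

Lemma mnmZ_of_nonneg (w : 'rV[int]_n) :
  (forall k, 0 <= w 0 k) -> exists u, w = mnmZ u.
Proof.
move=> w_ge0; exists [multinom `|w ord0 k|%N | k < n].
by apply/rowP => k; rewrite mxE mnmE gez0_abs.
Qed.

Lemma mem_supp_mnmZ u k : (k \in supp (mnmZ u)) = (u k != 0%N).
Proof. by rewrite inE mxE. Qed.

Lemma supp_mnmZD u v : supp (mnmZ (u + v)) = supp (mnmZ u) :|: supp (mnmZ v).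
Proof.
by apply/setP => k; rewrite in_setU !mem_supp_mnmZ mnmDE addn_eq0 negb_and.
Qed.

Lemma supp_mnmZ0 : supp (mnmZ (0%MM : 'X_{1..n})) = set0.
Proof. by apply/setP => k; rewrite mem_supp_mnmZ mnm0E in_set0. Qed.

End MonomialsInZn.

Definition is_subgroup n (P : 'rV[int]_n -> Prop) : Prop :=
  P 0 /\ forall w1 w2, P w1 -> P w2 -> P (w1 - w2).

Lemma is_subgroup_combination n (P : 'rV[int]_n -> Prop) (I : finType)
    (c : I -> int) (d : I -> 'rV[int]_n) :
  is_subgroup P -> (forall i, P (d i)) -> P (\sum_i c i *: d i).
Proof.
move=> [P0 PB] Pd.
have PN w : P w -> P (- w) by move=> Pw; rewrite -sub0r; exact: PB.
have PD w1 w2 : P w1 -> P w2 -> P (w1 + w2).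
  by move=> Pw1 /PN Pw2; rewrite -[w2]opprK; exact: PB.
have PM (m : nat) w : P w -> P (m%:Z *: w).
  move=> Pw; elim: m => [|m IHm]; first by rewrite scale0r.
  by rewrite intS scalerDl scale1r; exact: PD.
elim/big_ind: _ => // i _; case: (c i) => m; first exact: PM.
by rewrite NegzE scaleNr; exact/PN/PM.
Qed.

(** * Monomials that are invertible modulo a congruence *)

Section InvertibleMonomials.
Variables (n : nat) (E : 'X_{1..n} -> 'X_{1..n} -> Prop).
Hypothesis congE : congruence E.
Implicit Types u v : 'X_{1..n}.

Definition invertible u := exists u', E (u + u')%MM 0%MM.

Lemma cong_add u v u' v' : E u v -> E u' v' -> E (u + u')%MM (v + v')%MM.
Proof.
move=> uv uv'; apply: (cong_trans congE (cong_addr congE u' uv)).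
by rewrite ![(v + _)%MM]addmC; exact: (cong_addr congE).
Qed.

Lemma invertible0 : invertible 0%MM.
Proof. by exists 0%MM; rewrite addm0; exact: (cong_refl congE). Qed.

Lemma invertibleD u v : invertible u -> invertible v -> invertible (u + v)%MM.
Proof.
move=> [u' uu'] [v' vv']; exists (u' + v')%MM.
have -> : (u + v + (u' + v') = (u + u') + (v + v'))%MM.
  by apply/mnmP => k; rewrite !mnmDE addnACA.
by rewrite -[X in E _ X]addm0; exact: cong_add.
Qed.

Lemma invertible_addl u v : invertible (u + v)%MM -> invertible u.
Proof. by move=> [w uvw]; exists (v + w)%MM; rewrite addmA. Qed.

Lemma invertible_congruent u v : E u v -> invertible v -> invertible u.
Proof.
move=> uv [w vw]; exists w.
exact: (cong_trans congE (cong_addr congE w uv)).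
Qed.

(** This reduces invertibility to supports: a product is invertible exactly when
    its factors are. *)
Lemma invertible_supp u :
  invertible u <-> forall k, k \in supp (mnmZ u) -> invertible U_(k)%MM.
Proof.
split=> [inv_u k|inv_u].
  rewrite mem_supp_mnmZ -lep1mP => /submK u_eq.
  by apply: (@invertible_addl _ (u - U_(k))%MM); rewrite addmC u_eq.
rewrite [u]multinomUE_id; elim/big_ind: _ => [||k _].
- exact: invertible0.
- exact: invertibleD.
have := inv_u k; rewrite mem_supp_mnmZ.
elim: (u k) => [|m IHm] inv_k; first by rewrite mulm0n; exact: invertible0.
rewrite mulmS; apply: invertibleD; first exact: inv_k.
by apply: IHm => _; exact: inv_k.
Qed.

Lemma congruent_cancel u v w :
  invertible w -> E (u + w)%MM (v + w)%MM -> E u v.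
Proof.
move=> [w' ww'] uvw.
have absorb x : E (x + w + w')%MM x.
  rewrite -addmA -[X in E _ X]addm0; apply: cong_add => //.
  exact: (cong_refl congE).
apply: (cong_trans congE (cong_sym congE (absorb u))).
exact: (cong_trans congE (cong_addr congE w' uvw)).
Qed.

(** The vectors that the congruence identifies with 0 in the localization at the
    invertible monomials. *)
Definition unit_difference (d : 'rV[int]_n) :=
  exists u v, [/\ E u v, invertible u, invertible v & d = mnmZ u - mnmZ v].

Lemma unit_difference_subgroup : is_subgroup unit_difference.
Proof.
split=> [|d1 d2 [u1 [v1 [E1 iu1 iv1 ->]]] [u2 [v2 [E2 iu2 iv2 ->]]]].
  exists 0%MM, 0%MM; rewrite subrr; split=> //; try exact: invertible0.
  exact: (cong_refl congE).
exists (u1 + v2)%MM, (v1 + u2)%MM; split; try exact: invertibleD.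
  exact/cong_add/(cong_sym congE).
by rewrite !mnmZD opprB opprD addrACA.
Qed.

(** If u - v = a - b with a congruent to b, then u + b = v + a is congruent to
    v + b, and the invertible b cancels. *)
Lemma congruent_of_unit_difference u v :
  unit_difference (mnmZ u - mnmZ v) -> E u v.
Proof.
move=> [x [y [Exy _ inv_y uv_xy]]].
apply: (congruent_cancel inv_y).
have -> : (u + y = v + x)%MM.
  apply: mnmZ_inj; rewrite !mnmZD; apply/eqP.
  by rewrite [mnmZ v + _]addrC -subr_eq -addrA [mnmZ y - _]addrC addrA uv_xy
    subrK.
by apply: cong_add => //; exact: (cong_refl congE).
Qed.

(** Going along the chain, v_i only involves variables of the earlier u_j, which
    are invertible, so v_i is invertible, and then so is u_i, being congruent to
    it. All the differences u_i - v_i are thus unit differences, and these form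
    a subgroup. *)
Lemma congruent_of_chain r (u v : 'I_r -> 'X_{1..n}) :
  (forall i, E (u i) (v i)) ->
  (forall i, supp (mnmZ (v i)) \subset
     \bigcup_(j : 'I_r | (j < i)%N) supp (mnmZ (u j))) ->
  forall x y (c : 'I_r -> int),
    mnmZ x - mnmZ y = \sum_i c i *: (mnmZ (u i) - mnmZ (v i)) -> E x y.
Proof.
move=> Euv chain.
have inv_v (i : 'I_r) :
    (forall j : 'I_r, (j < i)%N -> invertible (u j)) -> invertible (v i).
  move=> inv_u; apply/invertible_supp => k /(subsetP (chain i)).
  by case/bigcupP => j /inv_u /invertible_supp; exact.
have inv_u (i : 'I_r) : invertible (u i).
  have [m le_im] := ubnP i; elim: m => // m IHm in i le_im *.
  apply: (invertible_congruent (Euv i)); apply: inv_v => j lt_ji.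
  by apply: IHm; exact: leq_trans lt_ji _.
move=> x y c xy; apply: congruent_of_unit_difference; rewrite {}xy.
apply: (is_subgroup_combination _ unit_difference_subgroup) => i.
by exists (u i), (v i); split=> //; exact: inv_v.
Qed.

End InvertibleMonomials.

(** * Generating families of minimal size are bases *)

Lemma row_combination (m n : nat) (c : 'I_m -> int) (b : 'I_m -> 'rV[int]_n) :
  \sum_i c i *: b i = (\row_i c i) *m (\matrix_i b i).
Proof.
rewrite mulmx_sum_row; apply: eq_bigr => i _.
by rewrite mxE rowK.
Qed.

(** Let M and N be the square matrices that express the given family D in a basis
    B and B in D. Then N M B = B, so N M = 1 as B is free, and then M N = 1
    because a one-sided inverse of a square matrix over a commutative ring is
    two-sided. A relation c D = c M B = 0 gives c M = 0, hence c = c M N = 0. *)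
Lemma lattice_basis_of_generators (n r : nat) (L : zmodClosed 'rV[int]_n)
    (d : 'I_r -> 'rV[int]_n) :
  lattice_rank L r ->
  (forall i, d i \in L) ->
  (forall w, w \in L -> exists c : 'I_r -> int, w = \sum_i c i *: d i) ->
  lattice_basis L d.
Proof.
move=> [b [bL b_gen b_free]] dL d_gen; split=> // c.
have [M MP] := @fin_all_exists _ _ (fun i c => d i = \sum_j c j *: b j)
  (fun i => b_gen _ (dL i)).
have [N NP] := @fin_all_exists _ _ (fun i c => b i = \sum_j c j *: d j)
  (fun i => d_gen _ (bL i)).
pose MM := \matrix_(i, j) M i j; pose NN := \matrix_(i, j) N i j.
pose D := \matrix_i d i; pose B := \matrix_i b i.
have free_mx (A : 'rV[int]_r) : A *m B = 0 -> A = 0.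
  move=> AB0; apply/rowP => j; rewrite [RHS]mxE.
  apply: (b_free (fun j => A 0 j)); rewrite row_combination.
  by apply: etrans AB0; congr (_ *m _); apply/rowP => i; rewrite mxE.
have DE : D = MM *m B.
  apply/row_matrixP => i; rewrite row_mul rowK MP row_combination.
  by congr (_ *m _); apply/rowP => j; rewrite !mxE.
have BE : B = NN *m D.
  apply/row_matrixP => i; rewrite row_mul rowK NP row_combination.
  by congr (_ *m _); apply/rowP => j; rewrite !mxE.
have NM1 : NN *m MM = 1%:M.
  apply/row_matrixP => i; apply/eqP; rewrite -subr_eq0; apply/eqP.
  apply: free_mx.
  by rewrite mulmxBl -!row_mul -mulmxA -DE -BE mul1mx subrr.
rewrite row_combination -/D DE mulmxA => /free_mx cM0 i.
have : \row_i c i = 0 by rewrite -[LHS]mulmx1 -(mulmx1C NM1) mulmxA cM0 mul0mx.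
by move/rowP/(_ i); rewrite !mxE.
Qed.

(** * Greedy orderings *)

(** Each index i carries two sets, A i true and A i false. The output f lists the
    indices, and o i tells which of the two sets of f i is added to the
    accumulated union; the other one must already be in it. Consequently both
    sets of a listed index are in the union, which is what the extension
    hypothesis asks for. *)
Lemma greedy_ordering (T : finType) (r : nat) (A : 'I_r -> bool -> {set T}) :
  (forall (C : {set 'I_r}) (X : {set T}), C != setT ->
     (forall i o, i \in C -> A i o \subset X) ->
     exists i o, i \notin C /\ A i o \subset X) ->
  exists (f : 'I_r -> 'I_r) (o : 'I_r -> bool), injective f /\
    forall i, A (f i) (~~ o i) \subset
      \bigcup_(j : 'I_r | (j < i)%N) A (f j) (o j).
Proof.
move=> extend.
pose reached f o m := \bigcup_(j : 'I_r | (j < m)%N) A (f j) (o j).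
(* A partial ordering of m indices is a total function on 'I_r of which only the
   values below m matter; the identity serves for m = 0, even when r = 0. *)
have step m : (m <= r)%N -> exists (f : 'I_r -> 'I_r) (o : 'I_r -> bool),
    {in [pred i : 'I_r | (i < m)%N] &, injective f} /\
    forall i : 'I_r, (i < m)%N -> A (f i) (~~ o i) \subset reached f o i.
  elim: m => [_|m IHm lt_mr]; first by exists id, xpredT.
  have [f [o [f_inj chain]]] := IHm (ltnW lt_mr).
  pose C := f @: [set j : 'I_r | (j < m)%N].
  have C_proper : C != setT.
    rewrite eqEcard subsetT /= cardsT card_ord -ltnNge.
    apply: leq_ltn_trans (leq_imset_card _ _) _.
    have sub : [set j : 'I_r | (j < m)%N] \subset [set~ Ordinal lt_mr].
      apply/subsetP => j; rewrite !inE => lt_jm.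
      by apply/eqP => jm; rewrite jm ltnn in lt_jm.
    apply: leq_ltn_trans (subset_leq_card sub) _.
    by rewrite cardsC1 card_ord prednK // (leq_trans _ lt_mr).
  have C_reached i b : i \in C -> A i b \subset reached f o m.
    case/imsetP => j; rewrite inE => lt_jm ->.
    have [->|b_neq] := eqVneq b (o j); first exact: (bigcup_sup j).
    have -> : b = ~~ o j by case: b (o j) b_neq => [] [].
    apply: subset_trans (chain j lt_jm) _; apply/bigcupsP => l lt_lj.
    by apply: (bigcup_sup l) => //; exact: ltn_trans lt_jm.
  have [i0 [b0 [i0C i0_sub]]] := extend C (reached f o m) C_proper C_reached.
  exists (fun j : 'I_r => if j == m :> nat then i0 else f j).
  exists (fun j : 'I_r => if j == m :> nat then ~~ b0 else o j).
  have old (j : 'I_r) : (j < m)%N -> (j == m :> nat) = false.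
    by move=> lt_jm; rewrite ltn_eqF.
  have same (l : nat) : (l <= m)%N ->
      reached (fun j : 'I_r => if j == m :> nat then i0 else f j)
        (fun j : 'I_r => if j == m :> nat then ~~ b0 else o j) l = reached f o l.
    move=> le_lm; apply: eq_bigr => j lt_jl.
    by rewrite old // (leq_trans lt_jl).
  have fC (j : 'I_r) : (j < m)%N -> f j \in C.
    by move=> lt_jm; apply: imset_f; rewrite inE.
  split=> [i j|i].
    rewrite !inE !ltnS => le_im le_jm.
    case: eqP => [im|/eqP im]; case: eqP => [jm|/eqP jm].
    - by move=> _; apply: val_inj; rewrite /= im jm.
    - by move=> i0E; rewrite i0E fC ?ltn_neqAle ?jm // in i0C.
    - by move=> i0E; rewrite -i0E fC ?ltn_neqAle ?im // in i0C.
    - by apply: f_inj; rewrite inE ltn_neqAle ?im ?jm.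
  rewrite ltnS => le_im; rewrite same //.
  case: eqP => [->|/eqP im]; first by rewrite negbK.
  by apply: chain; rewrite ltn_neqAle im.
have [f [o [f_inj chain]]] := step r (leqnn r).
exists f, o; split=> [i j|i]; first by apply: f_inj; rewrite inE ltn_ord.
by apply: chain.
Qed.

(** * Binomial generators of pure lattice ideals *)

(** In terms of ideals: the binomials x^u - x^v with both monomials in the
    polynomial ring on the variables of X and u - v in P, or with both monomials
    in the ideal generated by the other variables. *)
Definition face_congruent n (X : {set 'I_n}) (P : 'rV[int]_n -> Prop)
    (u v : 'X_{1..n}) : Prop :=
  (supp (mnmZ u) \subset X) = (supp (mnmZ v) \subset X) /\
  (supp (mnmZ u) \subset X -> P (mnmZ u - mnmZ v)).

Lemma face_congruence n (X : {set 'I_n}) (P : 'rV[int]_n -> Prop) :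
  is_subgroup P -> congruence (face_congruent X P).
Proof.
move=> [P0 PB]; have PN w : P w -> P (- w) by rewrite -sub0r; exact: PB.
split=> [u|u v [uv Puv]|v u w [uv Puv] [vw Pvw]|w u v [uv Puv]].
- by split=> // _; rewrite subrr.
- by split=> // vX; rewrite -opprB; apply/PN/Puv; rewrite uv.
- split=> [|uX]; first by rewrite uv.
  have -> : mnmZ u - mnmZ w = mnmZ u - mnmZ v - (- (mnmZ v - mnmZ w)).
    by rewrite opprK addrA subrK.
  by apply: PB; [exact: Puv | apply/PN/Pvw; rewrite -uv].
- rewrite /face_congruent !supp_mnmZD !subUset uv; split=> // /andP[vX _].
  by rewrite !mnmZD opprD addrACA subrr addr0; apply: Puv; rewrite uv.
Qed.

Lemma lattice_congruence n (L : zmodClosed 'rV[int]_n) :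
  congruence (fun u v : 'X_{1..n} => mnmZ u - mnmZ v \in L).
Proof.
split=> [u|u v|v u w uv vw|w u v].
- by rewrite subrr rpred0.
- by rewrite -opprB rpredN.
- by rewrite -(subrK (mnmZ v) (mnmZ u)) -addrA rpredD.
- by rewrite !mnmZD opprD addrACA subrr addr0.
Qed.

(** A nonnegative w in L gives x^w - 1 in the ideal. As 0 is supported in X, the
    congruence puts w in P. Purity extends this to all of L. *)
Lemma pure_lattice_sub_subgroup (K : fieldType) n (L : zmodClosed 'rV[int]_n)
    (G : {mpoly K[n]} -> Prop) (X : {set 'I_n}) (P : 'rV[int]_n -> Prop) :
  pure_lattice L -> is_subgroup P ->
  (forall g, G g ->
     exists u v, face_congruent X P u v /\ g = 'X_[u] - 'X_[v]) ->
  (forall p, lattice_ideal L p -> ideal_gen G p) ->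
  forall w, w \in L -> P w.
Proof.
move=> L_pure P_sub G_cong G_gen w /(L_pure w) [m [c [g [gP ->]]]].
apply: is_subgroup_combination => // i.
have [gL /mnmZ_of_nonneg [u gu]] := gP i.
have : lattice_ideal L ('X_[u] - 'X_[0] : {mpoly K[n]}).
  by apply: ideal_gen_id; exists u, 0%MM; rewrite mnmZ0 subr0 -gu.
move/G_gen/(congruent_of_ideal_gen (face_congruence X P_sub) G_cong) => [].
by rewrite supp_mnmZ0 sub0set gu mnmZ0 subr0 => uX; exact.
Qed.

Definition span_on n r (d : 'I_r -> 'rV[int]_n) (C : {set 'I_r}) w : Prop :=
  exists c : 'I_r -> int, (forall i, i \notin C -> c i = 0) /\
    w = \sum_i c i *: d i.

Lemma span_on_subgroup n r (d : 'I_r -> 'rV[int]_n) C : is_subgroup (span_on d C).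
Proof.
split=> [|w1 w2 [c1 [c1C ->]] [c2 [c2C ->]]].
  by exists (fun=> 0); split=> //; rewrite big1 // => i _; rewrite scale0r.
exists (fun i => c1 i - c2 i); split=> [i iC|]; first by rewrite c1C ?c2C ?subrr.
by rewrite -sumrB; apply: eq_bigr => i _; rewrite scalerBl.
Qed.

Lemma mem_span_on n r (d : 'I_r -> 'rV[int]_n) (C : {set 'I_r}) i :
  i \in C -> span_on d C (d i).
Proof.
move=> iC; exists (fun j => (j == i)%:Z); split=> [j|].
  by case: eqVneq => // ->; rewrite iC.
rewrite (bigD1 i) //= eqxx scale1r big1 ?addr0 // => j /negPf ->.
by rewrite scale0r.
Qed.

Lemma span_on_free n r (L : zmodClosed 'rV[int]_n) (d : 'I_r -> 'rV[int]_n)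
    (C : {set 'I_r}) i :
  lattice_basis L d -> span_on d C (d i) -> i \in C.
Proof.
move=> [_ _ d_free] [c [cC di]]; apply: contraT => iC.
have sum0 : \sum_j (c j - (j == i)%:Z) *: d j = 0.
  under eq_bigr do rewrite scalerBl.
  rewrite sumrB -di [X in _ - X](bigD1 i) //= eqxx scale1r big1 ?addr0 ?subrr //.
  by move=> j /negPf ->; rewrite scale0r.
by have := d_free _ sum0 i; rewrite /= eqxx cC.
Qed.

Section Generating.
Variables (K : fieldType) (n r : nat) (L : zmodClosed 'rV[int]_n).
Variables (s : 'I_r -> bool -> 'X_{1..n}) (G : {mpoly K[n]} -> Prop).
Hypotheses (L_pure : pure_lattice L) (L_rank : lattice_rank L r).
Hypothesis G_binomial :
  forall g, G g <-> exists i, g = 'X_[s i true] - 'X_[s i false].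
Hypothesis G_gen : forall p, ideal_gen G p <-> lattice_ideal L p.

Let d i := mnmZ (s i true) - mnmZ (s i false).

Lemma lattice_sub_span_on (C : {set 'I_r}) (X : {set 'I_n}) :
  (forall i o, (supp (mnmZ (s i o)) \subset X) = (i \in C)) ->
  forall w, w \in L -> span_on d C w.
Proof.
move=> CX; apply: (pure_lattice_sub_subgroup (G := G) (X := X) L_pure
  (span_on_subgroup d C)) => [g /G_binomial [i ->]|p /G_gen //].
exists (s i true), (s i false); split=> //.
by split; rewrite !CX // => iC; exact: mem_span_on.
Qed.

(** The case where C and X are everything shows that the r differences span L. *)
Lemma generators_basis : lattice_basis L d.
Proof.
apply: lattice_basis_of_generators => // [i|w wL].
  apply: (congruent_of_ideal_gen (lattice_congruence L) (G :=
    fun p => exists u v, mnmZ u - mnmZ v \in L /\ p = 'X_[u] - 'X_[v])) => //.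
  by apply/G_gen/ideal_gen_id/G_binomial; exists i.
have [|c [_ wc]] := @lattice_sub_span_on setT setT _ w wL; last by exists c.
by move=> i o; rewrite subsetT inE.
Qed.

(** If every remaining binomial had both monomials outside of X, the chosen ones
    would span L, and in particular the difference of each remaining binomial,
    which contradicts the freeness of the family. *)
Lemma generators_greedy (C : {set 'I_r}) (X : {set 'I_n}) :
  C != setT ->
  (forall i o, i \in C -> supp (mnmZ (s i o)) \subset X) ->
  exists i o, i \notin C /\ supp (mnmZ (s i o)) \subset X.
Proof.
move=> C_proper CX.
have [/existsP[i /existsP[o /andP[iC ioX]]]|stuck] :=
  boolP [exists i, exists o, (i \notin C) && (supp (mnmZ (s i o)) \subset X)].
  by exists i, o.
case/negP: C_proper; apply/eqP/setP => i; rewrite inE.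
have [dL _ _] := generators_basis.
apply: (span_on_free generators_basis); apply: lattice_sub_span_on (dL i) => j o.
apply/idP/idP => [joX|/CX //]; apply: contraT => jC.
by case/negP: stuck; apply/existsP; exists j; apply/existsP; exists o; rewrite jC.
Qed.

End Generating.

(** By induction, supp(v_i) is in the support of L; and outside of supp(v_i) the
    vectors u_i and u_i - v_i have the same entries. *)
Lemma lattice_supp_chain n r (L : zmodClosed 'rV[int]_n)
    (u v : 'I_r -> 'X_{1..n}) :
  (forall i, mnmZ (u i) - mnmZ (v i) \in L) ->
  (forall i, supp (mnmZ (v i)) \subset
     \bigcup_(j : 'I_r | (j < i)%N) supp (mnmZ (u j))) ->
  forall (i : 'I_r) k,
    k \in supp (mnmZ (u i)) :|: supp (mnmZ (v i)) -> lattice_supp L k.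
Proof.
move=> uvL chain i k; have [m le_im] := ubnP i.
elim: m => // m IHm in i le_im *.
have v_case : k \in supp (mnmZ (v i)) -> lattice_supp L k.
  move/(subsetP (chain i)) => /bigcupP [j lt_ji k_uj].
  by apply: (IHm j); [exact: leq_trans lt_ji _ | rewrite in_setU k_uj].
rewrite in_setU => /orP [k_u|]; last exact: v_case.
have [/v_case //|k_v] := boolP (k \in supp (mnmZ (v i))).
exists (mnmZ (u i) - mnmZ (v i)); first exact: uvL.
move: k_u k_v; rewrite !mem_supp_mnmZ negbK => k_u /eqP k_v.
by rewrite inE !mxE k_v subr0.
Qed.

Theorem theorem4p1 (K : fieldType) (n r : nat) (L : zmodClosed 'rV[int]_n)
    (S : {fset {mpoly K[n]}})
    (L_pure : pure_lattice L)
    (L_rank : lattice_rank L r)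
    (S_card : #|` S | = r)
    (S_binomial : forall p, p \in S -> binomial_poly p)
    (S_in_IL : forall p, p \in S -> lattice_ideal L p) :
  generates S (@lattice_ideal K n L) <->
  exists u v : 'I_r -> 'X_{1..n},
    rearrangement S (fun i => 'X_[u i] - 'X_[v i]) /\
    [/\ lattice_basis L (fun i => mnmZ (u i) - mnmZ (v i)),
        forall (i : 'I_r) (k : 'I_n),
          k \in supp (mnmZ (u i)) :|: supp (mnmZ (v i)) -> lattice_supp L k,
        forall i : 'I_r, i = 0%N :> nat -> 'X_[v i] = 1 :> {mpoly K[n]}
      & forall i : 'I_r, (0 < i)%N ->
          supp (mnmZ (v i)) \subset
            \bigcup_(j : 'I_r | (j < i)%N) supp (mnmZ (u j))].
Proof.
split=> [S_gen|[u [v [[B [_ SB uvB] [[_ L_span _] _ v0 chain]]]]] p].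
  pose B (i : 'I_r) := nth 0 (enum_fset S) i.
  have BS i : B i \in S by apply: mem_nth; rewrite S_card.
  have B_inj : injective B.
    by move=> i j /eqP; rewrite nth_uniq ?fset_uniq ?S_card // => /eqP/val_inj.
  have SB p : p \in S <-> exists i, p = B i.
    split=> [pS|[i ->] //].
    have lt_pr : (index p (enum_fset S) < r)%N by rewrite -S_card index_mem.
    by exists (Ordinal lt_pr); rewrite /B nth_index.
  have [s Bs] : exists s : 'I_r -> bool -> 'X_{1..n},
      forall i, B i = 'X_[s i true] - 'X_[s i false].
    apply: (@fin_all_exists _ _ (fun i t => B i = 'X_[t true] - 'X_[t false])).
    move=> i; have [u [v [_ ->]]] := S_binomial _ (BS i).
    by exists (fun b => if b then u else v).
  have S_bin p : p \in S <-> exists i, p = 'X_[s i true] - 'X_[s i false].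
    by split=> [/SB [i ->]|[i ->]]; [exists i | apply/SB; exists i].
  have [f [o [f_inj chain]]] := greedy_ordering
    (generators_greedy L_pure L_rank S_bin S_gen).
  have [dL d_span _] := generators_basis L_pure L_rank S_bin S_gen.
  pose u i := s (f i) (o i); pose v i := s (f i) (~~ o i).
  have uv_basis : lattice_basis L (fun i => mnmZ (u i) - mnmZ (v i)).
    apply: lattice_basis_of_generators => // [i|w /d_span [c ->]].
      have := dL (f i); rewrite /u /v; case: (o i) => //=.
      by rewrite -opprB rpredN.
    exists (fun i => if o i then c (f i) else - c (f i)).
    rewrite (reindex_inj f_inj); apply: eq_bigr => i _.
    by rewrite /u /v; case: (o i) => //=; rewrite scaleNr -scalerN opprB.
  exists u, v; split; last split=> //.
  - exists (B \o f); split=> [|p|i]; first exact: inj_comp.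
      split=> [/SB [i ->]|[i ->] //=].
      by exists (invF f_inj i); rewrite /= f_invF.
    rewrite /= Bs /u /v; case: (o i) => /=; [by left|right].
    by rewrite opprB.
  - by case: uv_basis => uvL _ _; exact: lattice_supp_chain.
  - move=> i i0; rewrite (_ : v i = 0%MM) ?mpolyX0 //.
    apply/mnmP => k; rewrite mnm0E; apply/eqP; apply: contraT.
    rewrite -mem_supp_mnmZ => /(subsetP (chain i)) /bigcupP [j].
    by rewrite i0.
  - by move=> i _; exact: chain.
pose E (x y : 'X_{1..n}) :=
  ideal_gen (fun q => q \in S) ('X_[x] - 'X_[y] : {mpoly K[n]}).
have congE : congruence E := ideal_congruence _.
have Euv i : E (u i) (v i).
  have BS : B i \in S by apply/SB; exists i.
  rewrite /E; have [->|->] := uvB i; first exact: ideal_gen_id.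
  by rewrite -mulN1r; exact/ideal_genM/ideal_gen_id.
have chain_all (i : 'I_r) : supp (mnmZ (v i)) \subset
    \bigcup_(j : 'I_r | (j < i)%N) supp (mnmZ (u j)).
  have [i_gt0|] := ltnP 0 i; first exact: chain.
  rewrite leqn0 => /eqP/v0/eqP; rewrite -mpolyX0 => /eqP.
  move/(congr1 (mcoeff (v i))); rewrite !mcoeffX eqxx.
  case: eqVneq => [<- _|_ /eqP]; last by rewrite oner_eq0.
  by rewrite supp_mnmZ0 sub0set.
split; first by apply: ideal_gen_sub => q /S_in_IL.
apply: ideal_gen_sub => q [x [y [/L_span [c xy] ->]]].
exact: (congruent_of_chain congE Euv chain_all xy).
Qed.
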